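(* Let $d,\delta,Len$ be positive integers, $z>0$ a real number with $z\le d\,\delta$, and $\beta\in[0,1)$. Put $\kappa_0=\lceil d/Len\rceil$ and $$\nu=\left\lfloor\frac{d\,\delta-z}{Len\,(1-\beta)}\right\rfloor .$$ Consider the spot-maximization problem (P) defined in the context. Then a solution $(\kappa_1;o^1,\dots,o^{\kappa_1})$ of (P) is optimal if it is of the following form: (i) $\displaystyle\sum_{i=1}^{\kappa_1-1}(\delta-o^i)=\min\{\nu,\ (\kappa_0-1)\,\delta\}$, and (ii) $o^{\kappa_1}=0$.
   Context: Setting: a job with workload $z$, parallelism bound $\delta$ and relative deadline $d$ (in slots) is to be processed by on-demand and spot instances. An hour has $Len$ slots and allocations are updated hourly; at the $i$-th update $o^i$ on-demand instances are acquired and $\delta-o^i$ spot instances are bid for. The expected time for which the spot instances can be used in an hour is $\beta\,Len$ slots. $\kappa_1$ is the number of allocation updates at which the job has flexibility to use spot instances. Problem (P): the variables are an integer $\kappa_1\ge 1$ and integers $o^1,\dots,o^{\kappa_1}\in[0,\delta]$. Maximize $$\sum_{i=1}^{\kappa_1}(\delta-o^i)\cdot Len\cdot\beta$$ subject to (a) $\kappa_1\le\kappa_0$; (b) $\displaystyle\sum_{i=1}^{\kappa_1-1}(\delta-o^i)\,Len\,(1-\beta)\le d\,\delta-z$; (c) $\displaystyle\sum_{i=1}^{\kappa_1}(\delta-o^i)\,Len\,(1-\beta)> d\,\delta-z$, where this constraint (expressing that there is no flexibility at the $(\kappa_1+1)$-th update) is regarded as automatically satisfied when $\kappa_1=\kappa_0$,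 since then no time remains after the $\kappa_1$-th hour. A ''solution'' of (P) is a feasible point, and it is ''optimal'' if its objective value is maximal among all feasible points. *)

(* Defs.v *)
From mathcomp Require Import all_boot all_order all_algebra.
From mathcomp Require Import reals.
Set Implicit Arguments.
Unset Strict Implicit.
Unset Printing Implicit Defensive.
Import Order.TTheory GRing.Theory Num.Theory.
Local Open Scope ring_scope.

(* The allocation (o^1, ..., o^kappa1) is given by the values at 1, ..., kappa1
   of a function o : nat -> int; no definition below depends on its other
   values. *)

Definition kappa0 (R : realType) (d Len : nat) : int :=
  Num.ceil (d%:R / Len%:R : R).

Definition nu (R : realType) (d delta Len : nat) (z beta : R) : int :=
  Num.floor (((d * delta)%:R - z) / (Len%:R * (1 - beta))).

Definition objective (R : realType) (delta Len : nat) (beta : R)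
    (kappa1 : nat) (o : nat -> int) : R :=
  \sum_(1 <= i < kappa1.+1) (delta%:Z - o i)%:~R * Len%:R * beta.

(* In the last conjunct, reaching kappa1 = kappa0 waives the constraint that no
   flexibility is left at the next update: no time remains then. *)
Definition feasible (R : realType) (d delta Len : nat) (z beta : R)
    (kappa1 : nat) (o : nat -> int) : Prop :=
  [/\ (1 <= kappa1)%N,
      (forall i : nat, (1 <= i <= kappa1)%N -> 0 <= o i <= delta%:Z),
      kappa1%:Z <= kappa0 R d Len,
      \sum_(1 <= i < kappa1) (delta%:Z - o i)%:~R * Len%:R * (1 - beta)
        <= (d * delta)%:R - z
    & kappa1%:Z != kappa0 R d Len ->
      \sum_(1 <= i < kappa1.+1) (delta%:Z - o i)%:~R * Len%:R * (1 - beta)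
        > (d * delta)%:R - z].

Definition optimal (R : realType) (d delta Len : nat) (z beta : R)
    (kappa1 : nat) (o : nat -> int) : Prop :=
  feasible d delta Len z beta kappa1 o /\
  forall (kappa1' : nat) (o' : nat -> int),
    feasible d delta Len z beta kappa1' o' ->
    objective delta Len beta kappa1' o' <= objective delta Len beta kappa1 o.

(* Main.v *)
(* The objective is a nonnegative multiple of the number of spot requests. In a
   feasible point the requests before the last update number at most nu, by
   constraint (b) and integrality, and at most (kappa0 - 1) * delta; the last
   update adds at most delta. The stated form attains both bounds. *)
Require Import Defs.
From mathcomp Require Import all_boot all_order all_algebra.
From mathcomp Require Import reals.
Set Implicit Arguments.
Unset Strict Implicit.
Unset Printing Implicit Defensive.
Import Order.TTheory GRing.Theory Num.Theory.
Local Open Scope ring_scope.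

(** Isolates an integer sum in constraint (b) and in the objective, so that floors and integer
    comparison apply to it. *)
Lemma sum_intr_mul (R : realType) (m n : nat) (F : nat -> int) (a b : R) :
  \sum_(m <= i < n) (F i)%:~R * a * b = (\sum_(m <= i < n) F i)%:~R * (a * b).
Proof.
by rewrite rmorph_sum mulr_suml; apply: eq_bigr => i _; rewrite mulrA.
Qed.

Lemma feasible_sum_le_nu (R : realType) (d delta Len : nat) (z beta : R)
    (kappa1 : nat) (o : nat -> int) :
  (0 < Len)%N -> beta < 1 -> feasible d delta Len z beta kappa1 o ->
  \sum_(1 <= i < kappa1) (delta%:Z - o i) <= nu d delta Len z beta.
Proof.
move=> hLen hbeta [_ _ _ hb _].
rewrite sum_intr_mul in hb.
by rewrite /nu floor_ge_int ler_pdivlMr // mulr_gt0 ?ltr0n ?subr_gt0.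
Qed.

Lemma feasible_sum_le_kappa0 (R : realType) (d delta Len : nat) (z beta : R)
    (kappa1 : nat) (o : nat -> int) :
  feasible d delta Len z beta kappa1 o ->
  \sum_(1 <= i < kappa1) (delta%:Z - o i) <= (kappa0 R d Len - 1) * delta%:Z.
Proof.
move=> [hk ho ha _ _].
apply: (@le_trans _ _ (\sum_(1 <= i < kappa1) delta%:Z)).
  apply: ler_sum_nat => i /andP[i1 ik].
  have /andP[o0 _] : 0 <= o i <= delta%:Z by apply: ho; rewrite i1 ltnW.
  by rewrite gerBl.
rewrite sumr_const_nat -mulr_natl ler_wpM2r //.
(* Since [1 <= kappa1], the natural subtraction [kappa1 - 1] is not truncated, and constraint (a)
   bounds it by [kappa0 - 1]. *)
by rewrite natz -subzn // lerB.
Qed.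

Theorem proposition4p4 (R : realType) (d delta Len : nat) (z beta : R)
    (hd : (0 < d)%N) (hdelta : (0 < delta)%N) (hLen : (0 < Len)%N)
    (hz : 0 < z) (hzd : z <= (d * delta)%:R) (hbeta : 0 <= beta < 1)
    (kappa1 : nat) (o : nat -> int)
    (hfeas : feasible d delta Len z beta kappa1 o)
    (hsum : \sum_(1 <= i < kappa1) (delta%:Z - o i) =
            Num.min (nu d delta Len z beta)
                    ((kappa0 R d Len - 1) * delta%:Z))
    (hlast : o kappa1 = 0) :
  optimal d delta Len z beta kappa1 o.
Proof.
split=> // k' o' hfeas'.
have /andP[beta_ge0 beta_lt1] := hbeta.
have [hk _ _ _ _] := hfeas.
have [hk' ho' _ _ _] := hfeas'.
(* The common factor [Len * beta] is nonnegative, so comparing the integer sums suffices. *)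
rewrite /objective !sum_intr_mul ler_wpM2r ?mulr_ge0 // ler_int.
(* Earlier updates and the last one are compared separately; [o kappa1 = 0] makes the last term
   exactly [delta]. *)
rewrite !big_nat_recr //= hsum hlast subr0 lerD //.
  by rewrite le_min (feasible_sum_le_nu hLen) // (feasible_sum_le_kappa0 hfeas').
have /andP[o0 _] : 0 <= o' k' <= delta%:Z by apply: ho'; rewrite hk' leqnn.
by rewrite gerBl.
Qed.
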